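(* Let $N\ge 2$ and $1\le a\le N-1$ be integers. For any subset $K=\{k_0,\dots,k_a\}\subset\{1,\ldots,N\}$ with $k_0<k_1<\dots<k_a$ (so $|K|=a+1$), $$ \mathcal M^a_{N}(x_1,\dots,x_N)=\sum_{\substack{J\subseteq K\\ J\neq\emptyset}}(-1)^{|J|-1}\,t^{\binom{|J|}{2}}\Bigg(\prod_{j\in K\setminus J}\ \prod_{i\in J}\frac{t x_j-x_i}{x_j-x_i}\Bigg)\,\mathcal M^a_{N-|J|}\big(\{x_k\}_{k\in\{1,\dots,N\}\setminus J}\big) $$ as operators on rational functions in $x_1,\dots,x_N$.
   Context: Let $q,t$ be formal parameters and $x_1,\dots,x_N$ independent variables. $\Gamma_i$ denotes the $q$-shift operator replacing $x_i$ by $q x_i$ and fixing the other variables, and $\Gamma_I=\prod_{i\in I}\Gamma_i$. Rational functions act by multiplication. For a finite index set $A\subset\{1,\dots,N\}$, the (original) Macdonald operator of level $a$ in the variables $\{x_k\}_{k\in A}$ is $$ \mathcal M^a_{|A|}(\{x_k\}_{k\in A}):=t^{\binom a2}\sum_{\substack{I\subset A\\ |I|=a}}\Bigg(\prod_{i\in I}\prod_{j\in A\setminus I}\frac{t x_i-x_j}{x_i-x_j}\Bigg)\Gamma_I , $$ and $\mathcal M^a_N(x_1,\dots,x_N)$ is the case $A=\{1,\dots,N\}$. The operator is $0$ (empty sum) if $|A|<a$. Empty products equal $1$. *)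

(* Defs.v *)
From HB Require Import structures.
From mathcomp Require Import all_boot all_order all_algebra.
From mathcomp Require Import mpoly.

Set Implicit Arguments.
Unset Strict Implicit.
Unset Printing Implicit Defensive.

Import GRing.Theory.

Local Open Scope ring_scope.

Notation "x %:F" := (@FracField.tofrac _ x) : ring_scope.

(* The coefficient field k(q, t), with q and t independent indeterminates.    *)
(* The x_k are adjoined on top of it, so rational functions in x_1, ..., x_N  *)
(* form the field k(q, t)(x_1, ..., x_N) = k(q, t, x_1, ..., x_N).            *)
Definition qtfield (k : fieldType) : fieldType := {fraction {mpoly k[2]}}.
Definition qpar (k : fieldType) : qtfield k := ('X_(ord0 : 'I_2))%:F.
Definition tpar (k : fieldType) : qtfield k := ('X_(ord_max : 'I_2))%:F.

Definition ratfun (F : fieldType) (N : nat) : fieldType :=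
  {fraction {mpoly F[N]}}.

Section MacdonaldOperators.

Variables (F : fieldType) (N : nat).
Implicit Types (i j : 'I_N) (I A : {set 'I_N}).

Definition const (c : F) : ratfun F N := (c%:MP_[N])%:F.

Definition var (i : 'I_N) : ratfun F N := ('X_i)%:F.

Section Shift.

Variable (q : F).

Definition poly_shift i (p : {mpoly F[N]}) : {mpoly F[N]} :=
  p \mPo [tuple (if j == i then q *: 'X_j else 'X_j) | j < N].

(* The value does not depend on the chosen fraction as soon as q != 0:        *)
(* see shift_frac below.                                                      *)
Definition shift i (f : ratfun F N) : ratfun F N :=
  (poly_shift i \n_(repr f))%:F / (poly_shift i \d_(repr f))%:F.

Definition shift_set I : ratfun F N -> ratfun F N :=
  \big[comp/id]_(i in I) shift i.

End Shift.

(* The Macdonald operator of level a in the variables (x_k), k in A, as an    *)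
(* operator on rational functions in all N variables.                         *)
Definition macdonald (q t : F) (a : nat) (A : {set 'I_N})
    (f : ratfun F N) : ratfun F N :=
  const t ^+ 'C(a, 2) *
  \sum_(I : {set 'I_N} | (I \subset A) && (#|I| == a))
    (\prod_(i in I) \prod_(j in A :\: I)
       ((const t * var i - var j) / (var i - var j))) * shift_set q I f.

Section ShiftTheory.

Variables (q : F) (q_neq0 : q != 0).

Lemma poly_shift_inj i : injective (poly_shift q i).
Proof.
pose g := [tuple (if j == i then q^-1 *: 'X_j else 'X_j) | j < N]
  : N.-tuple {mpoly F[N]}.
apply: (can_inj (g := fun p => p \mPo g)) => p.
rewrite /poly_shift (comp_mpolyEX p) [LHS]raddf_sum [RHS]mpolyE /=.
apply: eq_bigr => m _; rewrite !comp_mpolyZ; congr (_ *: _).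
rewrite comp_mpolyX rmorph_prod /= [RHS]mpolyXE_id; apply: eq_bigr => j _.
rewrite rmorphXn /= tnth_mktuple; congr (_ ^+ _).
case: ifP => ji; rewrite ?comp_mpolyZ comp_mpolyXU -tnth_nth tnth_mktuple ji //.
by rewrite scalerA mulfV // scale1r.
Qed.

Lemma poly_shift_eq0 i p : (poly_shift q i p == 0) = (p == 0).
Proof.
have shift0 : poly_shift q i 0 = 0 by exact: raddf0.
by rewrite -[RHS](inj_eq (@poly_shift_inj i)) shift0.
Qed.

Lemma frac_numden (f : ratfun F N) : f = (\n_(repr f))%:F / (\d_(repr f))%:F.
Proof.
have d0 : \d_(repr f) != 0 by exact: denom_ratioP.
rewrite -[LHS]reprK -[repr f in LHS]Ratio_numden.
rewrite /GRing.inv /= /GRing.mul /=; unlock FracField.tofrac.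
rewrite -FracField.pi_inv -FracField.pi_mul /FracField.invf /FracField.mulf.
by rewrite !numden_Ratio ?oner_neq0 // mul1r mulr1.
Qed.

Lemma shift_frac i (p d : {mpoly F[N]}) : d != 0 ->
  shift q i (p%:F / d%:F) = (poly_shift q i p)%:F / (poly_shift q i d)%:F.
Proof.
move=> d0; set f := p%:F / d%:F; have := frac_numden f.
have e0 : \d_(repr f) != 0 by apply: denom_ratioP.
rewrite /shift {1}/f; move: (\n_ _) (\d_ _) e0 => n e e0.
have T (x : {mpoly F[N]}) : x != 0 -> x%:F != 0 by rewrite tofrac_eq0.
move/eqP; rewrite eqr_div ?T // -!tofracM tofrac_eq => /eqP eqpd.
apply/eqP; rewrite eqr_div ?T ?poly_shift_eq0 // -!tofracM tofrac_eq.
by rewrite /poly_shift -!rmorphM eqpd.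
Qed.

Lemma shift_poly i (p : {mpoly F[N]}) : shift q i p%:F = (poly_shift q i p)%:F.
Proof.
rewrite -[p%:F]divr1 -[X in _ / X]tofrac1 shift_frac ?oner_neq0 //.
by rewrite /poly_shift rmorph1 tofrac1 divr1.
Qed.

Lemma shift_const i c : shift q i (const c) = const c.
Proof. by rewrite /const shift_poly /poly_shift comp_mpolyC. Qed.

Lemma shift_var i j :
  shift q i (var j) = if j == i then const q * var j else var j.
Proof.
rewrite /var shift_poly /poly_shift comp_mpolyXU -tnth_nth tnth_mktuple.
by case: ifP => // _; rewrite -mul_mpolyC tofracM.
Qed.

Lemma shiftD i : {morph shift q i : f g / f + g}.
Proof.
move=> f g; rewrite (frac_numden f) (frac_numden g).
move: (\n_(repr f)) (\d_(repr f)) (denom_ratioP (repr f)) => n d d0.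
move: (\n_(repr g)) (\d_(repr g)) (denom_ratioP (repr g)) => m e e0.
have T (x : {mpoly F[N]}) : x != 0 -> x%:F != 0 by rewrite tofrac_eq0.
rewrite addf_div ?T // -!tofracM -tofracD !shift_frac ?mulf_neq0 //.
rewrite addf_div ?T ?poly_shift_eq0 // -!tofracM -tofracD.
by rewrite /poly_shift rmorphD !rmorphM.
Qed.

Lemma shiftM i : {morph shift q i : f g / f * g}.
Proof.
move=> f g; rewrite (frac_numden f) (frac_numden g).
move: (\n_(repr f)) (\d_(repr f)) (denom_ratioP (repr f)) => n d d0.
move: (\n_(repr g)) (\d_(repr g)) (denom_ratioP (repr g)) => m e e0.
rewrite mulf_div -!tofracM !shift_frac ?mulf_neq0 //.
by rewrite mulf_div -!tofracM /poly_shift !rmorphM.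
Qed.

End ShiftTheory.

End MacdonaldOperators.

Lemma qpar_neq0 (k : fieldType) : qpar k != 0.
Proof.
rewrite tofrac_eq0; apply/eqP => /(congr1 (mcoeff U_(ord0)%MM)).
by rewrite mcoeffX eqxx mcoeff0; apply/eqP/oner_neq0.
Qed.

(* Main.v *)
Require Import Defs.
From mathcomp Require Import all_boot all_order all_algebra.
From mathcomp Require Import mpoly.
From mathcomp Require Import ring zify.

Set Implicit Arguments.
Unset Strict Implicit.
Unset Printing Implicit Defensive.

Import GRing.Theory.

Local Open Scope ring_scope.

(** Both sides are combinations of the shifts Gamma_I with #|I| = a, so it is
    enough to compare, for each such I, their rational coefficients.  Write
    w(u, v) = (t u - v) / (u - v), L = K \ I and M = I \ K.  Only the J inside
    L contribute to Gamma_I on the right, and the left coefficient is the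
    missing term J = set0 with the opposite sign.  After removing the factors
    common to all J, the claim is that

      sum over J in L of (-1)^|J| t^C(|J|,2)
        prod_(j in L\J, i in J) w(x_j, x_i) prod_(j in L\J, m in M) w(x_m, x_j)

    vanishes, where |L| = |M| + 1 because |K| = a + 1 and |I| = a
    ([alternating_sum], used in [coefficient_identity]).

    This sum is, up to a nonzero factor, the expansion of a determinant.  Let
    Y and W be the monic polynomials of degree |M| whose roots are the x_m and
    the t x_m.  Consider the square matrix with entries

      t^|M| Y(x_i) x_i^k - W(x_i) (t x_i)^k      (i in L, 0 <= k < |L|).

    Each row is a sum of two rows; choosing for every i the first (i in J) or
    the second (i not in J) writes the determinant as a sum over J of
    Vandermonde determinants in which the x_i with i outside J are dilated by
    t ([det_add_rows], [det_scaled_powers]).  Dilating part of the variables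
    multiplies the Vandermonde product by a power of t and exactly the product
    of the w(x_j, x_i) ([vandermonde_dilation]), while the quotients
    W(x_j) / Y(x_j) are the products of the w(x_m, x_j).

    The determinant is zero ([det_two_term_rows]): since W(t z) = t^|M| Y(z),
    the coefficient vector of W, which has |M| + 1 = |L| entries, is sent to
    t^|M| Y(x_i) W(x_i) - W(x_i) W(t x_i) = 0. *)

(** * Products over ordered pairs of indices *)

Lemma big_lt_sym (R : Type) (idx : R) (op : Monoid.com_law idx) n
    (d : 'I_n -> 'I_n -> R) :
  \big[op/idx]_(i < n) \big[op/idx]_(j < n | (i < j)%N) op (d i j) (d j i) =
  \big[op/idx]_(i < n) \big[op/idx]_(j < n | j != i) d i j.
Proof.
under eq_bigr => i _ do rewrite big_split.
rewrite big_split /= [X in op _ X](exchange_big_dep predT) //= -big_split /=.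
apply: eq_bigr => i _; rewrite [RHS](bigID (fun j : 'I_n => (i < j)%N)) /=.
congr (op _ _); apply: eq_bigl => j; rewrite -val_eqE /=; lia.
Qed.

(** Doubling the sum symmetrises it into the count of the ordered pairs of
    distinct elements of P. *)
Lemma sum_lt_pairs n (P : {set 'I_n}) :
  (\sum_(i < n) \sum_(j < n | (i < j)%N) ((i \in P) && (j \in P)) =
   'C(#|P|, 2))%N.
Proof.
set d := fun i j : 'I_n => ((i \in P) && (j \in P) : nat).
have dbl : (\sum_(i < n) \sum_(j < n | (i < j)%N) (d i j + d j i) =
            #|P| * #|P|.-1)%N.
  rewrite big_lt_sym (bigID (mem P)) /= [X in (_ + X)%N]big1 => [|i /negbTE iP].
    rewrite addn0 -sum_nat_const; apply: eq_bigr => i iP.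
    rewrite (cardsD1 i P) iP /= -sum1_card big_mkcond [RHS]big_mkcond /=.
    apply: eq_bigr => j _.
    by rewrite /d iP !inE; case: (j == i); case: (j \in P).
  by rewrite big1 // => j _; rewrite /d iP.
rewrite bin2 -dbl.
have -> : (\sum_(i < n) \sum_(j < n | (i < j)%N) (d i j + d j i))%N =
   (\sum_(i < n) \sum_(j < n | (i < j)%N) d i j).*2%N.
  rewrite -muln2 big_distrl /=; apply: eq_bigr => i _; rewrite big_distrl /=.
  by apply: eq_bigr => j _; rewrite /d andbC; lia.
by rewrite doubleK.
Qed.

(** * Dilated Vandermonde determinants *)

(** The factor attached to a pair of variables in a Macdonald operator. *)
Definition weight (R : fieldType) (t u v : R) := (t * u - v) / (u - v).

(** A pair of indices contributes 1 if both lie in J, t if neither does, and a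
    weight if exactly one does.  In the mixed case the quotient of z j - z i by
    x j - x i does not depend on which of i and j is the smaller, so the order
    of the indices disappears from the result. *)
Lemma vandermonde_dilation (R : fieldType) n (t : R) (x : 'I_n -> R)
    (J : {set 'I_n}) (z := fun i => if i \in J then x i else t * x i) :
  injective x ->
  \prod_(i < n) \prod_(j < n | (i < j)%N) (z j - z i) =
  t ^+ 'C(#|~: J|, 2) *
  (\prod_(j in ~: J) \prod_(i in J) weight t (x j) (x i)) *
  \prod_(i < n) \prod_(j < n | (i < j)%N) (x j - x i).
Proof.
move=> xI.
(* d i j carries the mixed pairs, e i j the exponent of t; d is not symmetric,
   and d i j * d j i is the contribution of the unordered pair. *)
pose d i j := if (i \in ~: J) && (j \in J) then weight t (x i) (x j) else 1.
pose e i j : nat := (i \in ~: J) && (j \in ~: J).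
transitivity (\prod_(i < n) \prod_(j < n | (i < j)%N)
    (t ^+ e i j * (d i j * d j i) * (x j - x i))).
  apply: eq_bigr => i _; apply: eq_bigr => j lt_ij.
  have nz : x j - x i != 0.
    by rewrite subr_eq0 (inj_eq xI) -val_eqE /= gtn_eqF.
  have nz' : x i - x j != 0 by rewrite -opprB oppr_eq0.
  rewrite /z /d /e /weight !inE.
  by case: (i \in J) (j \in J) => [] [] /=; rewrite ?expr0 ?expr1; field.
under [LHS]eq_bigr => i _ do rewrite big_split /= big_split /=.
rewrite big_split /= big_split /= big_lt_sym; congr (_ * _ * _).
  under [LHS]eq_bigr => i _ do rewrite prodrXr.
  by rewrite prodrXr sum_lt_pairs.
rewrite [RHS]big_mkcond /=; apply: eq_bigr => i _.
case: ifP => iJ; last by rewrite big1 // => j _; rewrite /d iJ.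
rewrite big_mkcond [RHS]big_mkcond /=; apply: eq_bigr => j _.
rewrite /d iJ; case: eqP => //= ->; move: iJ; rewrite !inE.
by case: (i \in J).
Qed.

Lemma det_add_rows (R : comNzRingType) n (A B : 'M[R]_n) :
  \det (A + B) = \sum_(J : {set 'I_n})
    \det (\matrix_(i, j) if i \in J then A i j else B i j).
Proof.
rewrite /determinant exchange_big /=; apply: eq_bigr => s _.
rewrite -big_distrr /=; congr (_ * _).
under eq_bigr => i _ do rewrite mxE.
rewrite bigA_distr; apply: eq_big => J; first by rewrite inE.
by move=> _; apply: eq_bigr => i _; rewrite mxE.
Qed.

Lemma det_scaled_powers (R : comNzRingType) n (c z : 'I_n -> R) :
  \det (\matrix_(i, j) (c i * z i ^+ j)) =
  (\prod_i c i) * \prod_(i < n) \prod_(j < n | (i < j)%N) (z j - z i).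
Proof.
have -> : \matrix_(i, j) (c i * z i ^+ j) =
    diag_mx (\row_i c i) *m (Vandermonde n (\row_i z i))^T.
  by rewrite mul_diag_mx; apply/matrixP => i j; rewrite !mxE.
rewrite det_mulmx det_diag det_tr det_Vandermonde; congr (_ * _).
  by apply: eq_bigr => i _; rewrite mxE.
by apply: eq_bigr => i _; apply: eq_bigr => j _; rewrite !mxE.
Qed.

(** * Vanishing of the alternating sum *)

(** The coefficients of the polynomial W with roots t y form a nonzero kernel
    vector, because W (t z) = t ^+ size ys * prod (z - y).  The hypothesis says
    that W has as many coefficients as the matrix has columns. *)
Lemma det_two_term_rows (R : fieldType) n (t : R) (x : 'I_n -> R) (ys : seq R) :
  (size ys).+1 = n ->
  \det (\matrix_(i < n, j < n)
          ((t ^+ size ys * \prod_(y <- ys) (x i - y)) * x i ^+ j)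
        + \matrix_(i < n, j < n)
          (- \prod_(y <- ys) (x i - t * y) * (t * x i) ^+ j)) = 0.
Proof.
move=> size_ys; pose W := \prod_(y <- ys) ('X - (t * y)%:P).
have sizeW : size W = n by rewrite size_prod_XsubC.
have hornerW u : W.[u] = \prod_(y <- ys) (u - t * y).
  by rewrite horner_prod; apply: eq_bigr => y _; rewrite hornerXsubC.
rewrite -det_tr; apply/eqP/det0P; exists (\row_(j < n) W`_j).
  apply/eqP => /rowP W0.
  have : lead_coef W == 0.
    have ltn : (n.-1 < n)%N by rewrite -size_ys.
    by have := W0 (Ordinal ltn); rewrite !mxE lead_coefE sizeW /= => ->.
  by rewrite lead_coef_eq0 -size_poly_eq0 sizeW -size_ys.
apply/rowP => i; rewrite !mxE.
under eq_bigr => j _ do rewrite !mxE mulrDr !(mulrCA W`_j).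
rewrite big_split /= -!big_distrr /=.
rewrite -!horner_coef_wide ?sizeW // !hornerW.
have -> : \prod_(y <- ys) (t * x i - t * y) =
    t ^+ size ys * \prod_(y <- ys) (x i - y).
  under eq_bigr => y _ do rewrite -mulrBr.
  rewrite big_split /=; congr (_ * _).
  by rewrite big_const_seq count_predT iter_mulr_1.
by ring.
Qed.

(** With r + p = m + 1, this matches the power of t from the dilated
    Vandermonde product (p indices dilated) and from the m factors t in each of
    the r other rows with the power C(r, 2) of the alternating sum; the
    difference C(m + 1, 2) does not depend on r. *)
Lemma bin2_complement n m r p : (r + p = n)%N -> m.+1 = n ->
  ('C(n, 2) + 'C(r, 2) = m * r + 'C(p, 2))%N.
Proof.
move=> + mn; rewrite -mn => rp.
have dbl k : ('C(k, 2) * 2 = k * k.-1)%N by rewrite mulnC -mul_bin_diag bin1.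
have := dbl m.+1; have := dbl r; have := dbl p.
move: 'C(_, _) 'C(_, _) 'C(_, _) => u v w.
by case: r rp => [|r]; case: p => [|p] /= rp; nia.
Qed.

(** Up to the nonzero constant c, the terms of this sum are the terms of the
    row expansion of the determinant in [det_two_term_rows]. *)
Lemma alternating_sum_ord (R : fieldType) n (t : R) (x : 'I_n -> R)
    (ys : seq R) :
  t != 0 -> injective x -> (forall i, x i \notin ys) -> (size ys).+1 = n ->
  \sum_(J : {set 'I_n}) (-1) ^+ #|J| * t ^+ 'C(#|J|, 2) *
    (\prod_(j in ~: J) \prod_(i in J) weight t (x j) (x i)) *
    \prod_(j in ~: J) \prod_(y <- ys) weight t y (x j) = 0.
Proof.
move=> t0 xI xys size_ys; set m := size ys.
pose Y u := \prod_(y <- ys) (u - y); pose W u := \prod_(y <- ys) (u - t * y).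
pose V := \prod_(i < n) \prod_(j < n | (i < j)%N) (x j - x i).
have Y0 i : Y (x i) != 0.
  rewrite prodf_seq_neq0; apply/allP => y yys /=; rewrite subr_eq0.
  by apply: contraNneq (xys i) => ->.
have V0 : V != 0.
  apply/prodf_neq0 => i _; apply/prodf_neq0 => j lt_ij.
  by rewrite subr_eq0 (inj_eq xI) -val_eqE /= gtn_eqF.
have ratio j : \prod_(y <- ys) weight t y (x j) = W (x j) / Y (x j).
  rewrite -prodf_div; apply: eq_bigr => y _.
  by rewrite /weight -[t * y - _]opprB -[y - _]opprB invrN mulrNN.
pose c := (-1) ^+ n * t ^+ 'C(n, 2) * V * \prod_(j < n) Y (x j).
have c0 : c != 0.
  rewrite !mulf_neq0 ?expf_neq0 ?oppr_eq0 ?oner_neq0 //.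
  by apply/prodf_neq0.
apply/eqP; rewrite -(inj_eq (mulfI c0)) mulr0; apply/eqP.
rewrite -[RHS](det_two_term_rows t x size_ys) det_add_rows big_distrr /=.
apply: eq_bigr => J _.
pose z i := if i \in J then x i else t * x i.
pose a i := if i \in J then t ^+ m * Y (x i) else - W (x i).
have -> : \matrix_(i < n, j < n)
    (if i \in J then
      (\matrix_(i < n, j < n) (t ^+ m * Y (x i) * x i ^+ j)) i j
     else (\matrix_(i < n, j < n) (- W (x i) * (t * x i) ^+ j)) i j) =
   \matrix_(i < n, j < n) (a i * z i ^+ j).
  by apply/matrixP => i j; rewrite /a /z !mxE; case: ifP.
rewrite det_scaled_powers vandermonde_dilation // -/V.
have -> : \prod_i a i = t ^+ (m * #|J|) * (-1) ^+ #|~: J| *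
    (\prod_i Y (x i)) * \prod_(j in ~: J) \prod_(y <- ys) weight t y (x j).
  under [X in _ = _ * X]eq_bigr => j _ do rewrite ratio.
  rewrite prodf_div (bigID (mem J)) /= [X in _ * _ * X * _](bigID (mem J)) /=.
  have nJ F : \prod_(i | i \notin J) F i = \prod_(i in ~: J) F i :> R.
    by apply: eq_bigl => i; rewrite inE.
  rewrite !nJ.
  have -> : \prod_(i in J) a i = t ^+ (m * #|J|) * \prod_(i in J) Y (x i).
    rewrite exprM -prodr_const -big_split /=.
    by apply: eq_bigr => i iJ; rewrite /a iJ.
  have -> : \prod_(i in ~: J) a i = (-1) ^+ #|~: J| * \prod_(i in ~: J) W (x i).
    rewrite -prodrN; apply: eq_bigr => i; rewrite inE /a.
    by case: (i \in J).
  have : \prod_(i in ~: J) Y (x i) != 0 by apply/prodf_neq0.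
  by move=> ?; field.
have cJ : (#|J| + #|~: J| = n)%N by rewrite cardsC card_ord.
have signE : (-1) ^+ n = (-1) ^+ #|J| * (-1) ^+ #|~: J| :> R.
  by rewrite -exprD cJ.
have expt := bin2_complement cJ size_ys.
rewrite /c signE.
have sq : (-1) ^+ #|J| * (-1) ^+ #|J| = 1 :> R by rewrite -expr2 sqrr_sign.
have := congr1 (fun e => t ^+ e) expt; rewrite !exprD.
set t1 := t ^+ 'C(n, 2); set t2 := t ^+ 'C(#|J|, 2).
set t3 := t ^+ (_ * _); set t4 := t ^+ 'C(_, 2) => tE.
transitivity (((-1) ^+ #|J| * (-1) ^+ #|J|) * (t1 * t2) *
  (-1) ^+ #|~: J| * V * \prod_(j < n) Y (x j) *
  (\prod_(j in ~: J) \prod_(i in J) weight t (x j) (x i)) *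
    \prod_(j in ~: J) \prod_(y <- ys) weight t y (x j)); first by ring.
by rewrite sq tE; ring.
Qed.

(** The same identity for variables indexed by arbitrary finite sets, obtained
    by enumerating L; M only enters through the list of its values. *)
Lemma alternating_sum (R : fieldType) (T : finType) (t : R) (x : T -> R)
    (L M : {set T}) :
  t != 0 -> injective x -> [disjoint L & M] -> #|M|.+1 = #|L| ->
  \sum_(J : {set T} | J \subset L) (-1) ^+ #|J| * t ^+ 'C(#|J|, 2) *
    (\prod_(j in L :\: J) \prod_(i in J) weight t (x j) (x i)) *
    \prod_(j in L :\: J) \prod_(m in M) weight t (x m) (x j) = 0.
Proof.
move=> t0 xI dLM cardLM; pose h (i : 'I_#|L|) : T := enum_val i.
have hI : injective h by exact: enum_val_inj.
have hL i : h i \in L by exact: enum_valP.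
have hS u : u \in L -> exists i, u = h i.
  by move=> uL; exists (enum_rank_in uL u); rewrite /h enum_rankK_in.
have xys i : x (h i) \notin [seq x m | m <- enum M].
  by rewrite mem_map // mem_enum (disjointFr dLM (hL i)).
pose im (Q : {set 'I_#|L|}) : {set T} := h @: Q.
pose preim (J : {set T}) : {set 'I_#|L|} := h @^-1: J.
rewrite (reindex_onto im preim) /=; last first.
  move=> J JL; apply/setP => u; apply/imsetP/idP => [[i + ->]|uJ].
    by rewrite inE.
  by have [i ui] := hS u (subsetP JL u uJ); exists i; rewrite // inE -ui.
rewrite -[RHS](@alternating_sum_ord R _ t (x \o h) [seq x m | m <- enum M]) //.
- apply: eq_big => [Q|Q _].
    have -> : h @: Q \subset L by apply/subsetP => u /imsetP[i _ ->].
    by apply/eqP/setP => i; rewrite inE mem_imset.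
  have LQ : L :\: h @: Q = h @: (~: Q).
    apply/setP => u; rewrite inE.
    apply/andP/imsetP => [[uQ /hS[i ui]]|[i iQ ->]].
      by exists i; rewrite // inE; apply: contraNN uQ => iQ; rewrite ui imset_f.
    by rewrite hL mem_imset //; move: iQ; rewrite inE.
  rewrite LQ card_imset // !big_imset /=; try by move=> ? ? _ _ /hI.
  congr (_ * _ * _); apply: eq_bigr => j _.
    by rewrite big_imset //; move=> ? ? _ _ /hI.
  by rewrite big_map big_enum.
- exact: inj_comp.
- by rewrite size_map -cardE.
Qed.

(** * Comparison of the coefficients *)

(** The product on the left is the coefficient of the shift Gamma_I in the full
    operator; it is the term J = set0 of the alternating sum for L = K \ I and
    M = I \ K, multiplied by the factors that are the same for all J. *)
Lemma coefficient_identity (R : fieldType) (T : finType) (t : R) (x : T -> R)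
    (I K : {set T}) :
  t != 0 -> injective x -> #|K| = #|I|.+1 ->
  \prod_(i in I) \prod_(j in ~: I) weight t (x i) (x j) =
  \sum_(J : {set T} | (J \subset K :\: I) && (J != set0))
    (-1) ^+ (#|J| - 1) * t ^+ 'C(#|J|, 2) *
    (\prod_(j in K :\: J) \prod_(i in J) weight t (x j) (x i)) *
    \prod_(i in I) \prod_(j in ~: J :\: I) weight t (x i) (x j).
Proof.
move=> t0 xI cardK; pose w u v := weight t (x u) (x v).
have dLM : [disjoint K :\: I & I :\: K].
  by rewrite -setI_eq0; apply/eqP/setP => u; rewrite !inE; do 2!case: (u \in _).
have cLM : #|I :\: K|.+1 = #|K :\: I|.
  by have := cardsID I K; have := cardsID K I; rewrite setIC; lia.
have := alternating_sum t0 xI dLM cLM.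
(* Neither factor involves J: for the second one, the pairs in
   (I :&: K) * J come from the product over K :\: J, and the pairs in
   (I :&: K) * (L :\: J) from the operator in the variables outside J. *)
pose common := (\prod_(i in I) \prod_(j in ~: (I :|: K)) w i j) *
   \prod_(i in I :&: K) \prod_(j in K :\: I) w i j.
have split (J : {set T}) : J \subset K :\: I ->
    (\prod_(j in K :\: J) \prod_(i in J) w j i) *
    \prod_(i in I) \prod_(j in ~: J :\: I) w i j =
    common * (\prod_(j in (K :\: I) :\: J) \prod_(i in J) w j i) *
    \prod_(j in (K :\: I) :\: J) \prod_(m in I :\: K) w m j.
  move=> JL; have JK u : u \in J -> (u \in K) && (u \notin I).
    by move=> /(subsetP JL); rewrite inE andbC.
  rewrite (big_setID I) /=.
  have -> : (K :\: J) :&: I = I :&: K.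
    apply/setP => u; rewrite !inE; have := JK u.
    by case: (u \in J) (u \in K) (u \in I) => [] [] [] //= /(_ isT).
  have -> : K :\: J :\: I = K :\: I :\: J.
    by apply/setP => u; rewrite !inE andbCA.
  have E1 : \prod_(i in I) \prod_(j in ~: J :\: I) w i j =
     (\prod_(i in I) \prod_(j in ~: (I :|: K)) w i j) *
     \prod_(i in I) \prod_(j in K :\: I :\: J) w i j.
    rewrite -big_split; apply: eq_bigr => i _; rewrite [LHS](big_setID K) /= mulrC.
    congr (_ * _); apply: eq_bigl => u; rewrite !inE; have := JK u;
    by case: (u \in J) (u \in K) (u \in I) => [] [] [] //= /(_ isT).
  rewrite E1 [X in _ * (_ * X)](big_setID K) /=.
  have E2 : (\prod_(j in I :&: K) \prod_(i in J) w j i) *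
       \prod_(i in I :&: K) \prod_(j in K :\: I :\: J) w i j =
      \prod_(i in I :&: K) \prod_(j in K :\: I) w i j.
    rewrite -big_split; apply: eq_bigr => i _; rewrite [RHS](big_setID J) /=.
    by rewrite (setIidPr JL).
  rewrite /common -E2 [X in _ = _ * X]exchange_big /=; ring.
(* Isolate the term J = set0, whose factors indexed by J are empty. *)
rewrite (bigD1 set0) ?sub0set //= cards0 expr0 mul1r big1; last first.
  by move=> j _; rewrite big_set0.
rewrite setD0 !mul1r => /eqP; rewrite addr_eq0 => /eqP altE.
have := split set0; rewrite sub0set !setD0 => /(_ isT).
rewrite big1 ?mul1r; last by move=> j _; rewrite big_set0.
rewrite setC0 setTD [X in _ = _ * X * _]big1 => [|j _]; last by rewrite big_set0.
rewrite mulr1 => ->; rewrite altE mulrN mulr_sumr -sumrN.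
apply: eq_bigr => J /andP[JL J0]; rewrite -!mulrA [in RHS]split // -/w.
have -> : (-1) ^+ #|J| = - (-1) ^+ (#|J| - 1) :> R.
  by rewrite -[in LHS](subnK (n := #|J|) (m := 1)) ?card_gt0 // addn1 exprS mulN1r.
by rewrite /common /w; ring.
Qed.

Lemma var_inj (F : fieldType) N : injective (@var F N).
Proof.
move=> i j /eqP; rewrite tofrac_eq => /eqP /(congr1 (mcoeff U_(i)%MM)) /eqP.
by rewrite !mcoeffX eqxx eq_mnm1; case: (j =P i) => // _; rewrite oner_eq0.
Qed.

Lemma const_tpar_neq0 (k : fieldType) N : const N (tpar k) != 0.
Proof.
rewrite tofrac_eq0 mpolyC_eq0 tofrac_eq0; apply/eqP.
by move=> /(congr1 (mcoeff U_(ord_max)%MM)); rewrite mcoeffX eqxx mcoeff0;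
  apply/eqP/oner_neq0.
Qed.

Theorem theorem3p7 (k : fieldType) (N a : nat) (hN : (2 <= N)%N)
    (ha1 : (1 <= a)%N) (haN : (a <= N - 1)%N)
    (K : {set 'I_N}) (hK : #|K| = a.+1) (f : ratfun (qtfield k) N) :
  let q := qpar k in
  let t := tpar k in
  let T := const N t in
  let x := @var (qtfield k) N in
  macdonald q t a [set: 'I_N] f =
  \sum_(J : {set 'I_N} | (J \subset K) && (J != set0))
    (-1) ^+ (#|J| - 1) * T ^+ 'C(#|J|, 2) *
    (\prod_(j in K :\: J) \prod_(i in J) ((T * x j - x i) / (x j - x i))) *
    macdonald q t a (~: J) f.
Proof.
move=> q t T x; rewrite /macdonald -/T.
under [RHS]eq_bigr => J _ do rewrite mulrCA big_distrr.
rewrite -big_distrr /=; congr (_ * _).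
rewrite (exchange_big_dep (fun I : {set 'I_N} => #|I| == a)) /=; last first.
  by move=> J I _ /andP[].
apply: eq_big => [I|I /andP[_ /eqP cI]]; first by rewrite subsetT.
rewrite setTD (coefficient_identity (const_tpar_neq0 k N) (@var_inj _ _)
  (K := K)); last by rewrite hK cI.
rewrite big_distrl /=; apply: eq_big => [J|J _]; last by rewrite mulrA.
by rewrite subsetD cI eqxx andbT subsetC disjoints_subset andbAC.
Qed.
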